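(* Let $1\le p<q\le\infty$ (where $q$ may be $\infty$), and define $r\ (\ge p)$ by $\frac1p-\frac1q=\frac1r$. Then for every real $\varepsilon>0$ and every integer $n\ge1$, $$\mathrm{Widim}_\varepsilon\big(B_{\ell^p}(\mathbb{R}^n),d_{\ell^q}\big)\le \min\big(n,\ \lceil(2/\varepsilon)^r\rceil-1\big).$$ Consequently, for each fixed $\varepsilon>0$, the value $\mathrm{Widim}_\varepsilon(B_{\ell^p}(\mathbb{R}^n),d_{\ell^q})$ is constant for all sufficiently large $n$.
   Context: For a compact metric space $(X,d)$, a topological space $Y$ and $\varepsilon>0$, a continuous map $f:X\to Y$ is called an $\varepsilon$-embedding if $\mathrm{Diam}\, f^{-1}(y)\le\varepsilon$ for all $y\in Y$ (diameter with respect to $d$). $\mathrm{Widim}_\varepsilon(X,d)$ is the minimum integer $k\ge 0$ such that there exist a $k$-dimensional polyhedron $P$ (the underlying topological space of a $k$-dimensional simplicial complex) and an $\varepsilon$-embedding $f:X\to P$. For $1\le p<\infty$, $B_{\ell^p}(\mathbb{R}^n)=\{x\in\mathbb{R}^n : \sum_{k=1}^n|x_k|^p\le1\}$. For $1\le q<\infty$, $d_{\ell^q}(x,y)=\big(\sum_{k=1}^n|x_k-y_k|^q\big)^{1/q}$, and $d_{\ell^\infty}(x,y)=\max_{1\le k\le n}|x_k-y_k|$. The convention $1/\infty=0$ is used (so $r=p$ when $q=\infty$). $\lceil a\rceil$ denotes the smallest integer $\ge a$. *)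

(* Defs.v *)
From HB Require Import structures.
From mathcomp Require Import all_boot all_order all_algebra finmap.
From mathcomp Require Import all_classical all_reals all_analysis.

Set Implicit Arguments.
Unset Strict Implicit.
Unset Printing Implicit Defensive.

Import Order.TTheory GRing.Theory Num.Theory.
Import numFieldNormedType.Exports.

Local Open Scope classical_set_scope.
Local Open Scope ring_scope.

(* Abstract simplicial complexes, possibly infinite. *)
Record simplicial_complex (V : choiceType) := SimplicialComplex {
  simplex : set {fset V} ;
  simplex_neq0 : forall s, simplex s -> s != fset0 ;
  simplex_sub : forall s t,
    simplex s -> fsubset t s -> t != fset0 -> simplex t }.

Definition has_dim (V : choiceType) (K : simplicial_complex V) (k : nat) :=
  (exists2 s, simplex K s & #|` s| = k.+1) /\
  forall s, simplex K s -> (#|` s| <= k.+1)%N.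

(* w is the family of barycentric coordinates of a point of the closed
   simplex |s|. *)
Definition barycentric (R : realType) (V : choiceType) (s : {fset V})
    (w : V -> R) :=
  [/\ forall v, 0 <= w v, forall v, v \notin s -> w v = 0
    & \sum_(v <- s) w v = 1].

(* The geometric realization |K|. *)
Record polyhedron (R : realType) (V : choiceType) (K : simplicial_complex V) :=
  Polyhedron {
    bary :> V -> R ;
    baryP : exists2 s, simplex K s & barycentric s bary }.

Section polyhedron_topology.
Context {R : realType} {V : choiceType} {K : simplicial_complex V}.

HB.instance Definition _ := gen_eqMixin (polyhedron R K).
HB.instance Definition _ := gen_choiceMixin (polyhedron R K).

(* The coherent (weak) topology: U is open iff its trace on every closed
   simplex |s| is open for the Euclidean topology of |s|. *)
Definition polyhedron_open (U : set (polyhedron R K)) :=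
  forall s, simplex K s -> forall x, U x -> barycentric s x ->
    exists2 e : R, 0 < e & forall y : polyhedron R K, barycentric s y ->
      (forall v, `|x v - y v| < e) -> U y.

Let openT : polyhedron_open setT.
Proof. by move=> s Ks x _ _; exists 1. Qed.

Let openI : setI_closed polyhedron_open.
Proof.
move=> A B oA oB s Ks x [Ax Bx] sx.
have [e e0 eA] := oA s Ks x Ax sx; have [d d0 dB] := oB s Ks x Bx sx.
exists (Num.min e d) => [|y sy xy]; first by rewrite lt_min e0 d0.
split; [apply: eA => // v|apply: dB => // v].
  by have := xy v; rewrite lt_min => /andP[].
by have := xy v; rewrite lt_min => /andP[].
Qed.

Let open_bigU (I : Type) (F : I -> set (polyhedron R K)) :
  (forall i, polyhedron_open (F i)) -> polyhedron_open (\bigcup_i F i).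
Proof.
move=> oF s Ks x [i _ Fix] sx; have [e e0 eF] := oF i s Ks x Fix sx.
by exists e => // y sy xy; exists i => //; exact: eF.
Qed.

HB.instance Definition _ :=
  isOpenTopological.Build (polyhedron R K) openT openI open_bigU.

End polyhedron_topology.

(* diam set0 = -oo, which is below every real bound. *)
Definition diam (R : realType) (X : metricType R) (A : set X) : \bar R :=
  ereal_sup [set (mdist u.1 u.2)%:E | u in A `*` A].

Definition eps_embedding (R : realType) (X : metricType R)
    (Y : topologicalType) (eps : R) (f : X -> Y) :=
  continuous f /\ forall y, (diam (f @^-1` [set y]) <= eps%:E)%E.

Definition eps_embeds_in_dim (R : realType) (X : metricType R) (eps : R)
    (k : nat) :=
  exists (V : choiceType) (K : simplicial_complex V) (f : X -> polyhedron R K),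
    has_dim K k /\ eps_embedding eps f.

(* Widim_eps X = k *)
Definition is_Widim (R : realType) (X : metricType R) (eps : R) (k : nat) :=
  eps_embeds_in_dim X eps k /\
  forall j, eps_embeds_in_dim X eps j -> (k <= j)%N.

(* The value at q = -oo is junk: only 1 <= q is ever used. *)
Definition lq_dist (R : realType) (n : nat) (q : \bar R) (x y : 'rV[R]_n) : R :=
  match q with
  | r%:E => (\sum_i `|x 0 i - y 0 i| `^ r) `^ r^-1
  | +oo%E => \big[Num.max/0]_i `|x 0 i - y 0 i|
  | -oo%E => 0
  end.

Section lq_metric.
Context {R : realType} (n : nat).
Implicit Types (q : \bar R) (x y z : 'rV[R]_n).

Lemma lq_dist_sym q x y : lq_dist q x y = lq_dist q y x.
Proof.
have E : (fun i => `|x 0 i - y 0 i|) = (fun i => `|y 0 i - x 0 i|).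
  by apply/funext => i; rewrite (distrC (x 0 i)).
pose F (g : 'I_n -> R) : R := match q with
  | r%:E => (\sum_i g i `^ r) `^ r^-1
  | +oo%E => \big[Num.max/0]_i g i
  | -oo%E => 0 end.
exact: (congr1 F E).
Qed.

Lemma lq_distxx q x : (1 <= q)%E -> lq_dist q x x = 0.
Proof.
case: q => [r||] //=.
  rewrite lee_fin => r1; have r0 : r != 0 by rewrite gt_eqF ?(lt_le_trans _ r1).
  by rewrite big1 ?powR0 ?invr_eq0// => i _; rewrite subrr normr0 powR0.
by move=> _; apply: big1_idem; [exact: maxxx|move=> i _; rewrite subrr normr0].
Qed.

Lemma lq_dist_eq0 q x y : (1 <= q)%E -> lq_dist q x y = 0 -> x = y.
Proof.
case: q => [r||] //= => [_ /powR_eq0_eq0 h|_ h].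
  have {}h i : `|x 0 i - y 0 i| `^ r = 0.
    have /psumr_eq0P /(_ h i isT) // : forall i, true ->
      0 <= `|x 0 i - y 0 i| `^ r by move=> ? _; exact: powR_ge0.
  apply/rowP => i; apply/eqP; rewrite -subr_eq0 -normr_eq0; apply/eqP.
  exact: powR_eq0_eq0 (h i).
apply/rowP => i; apply/eqP; rewrite -subr_eq0 -normr_le0 -h.
exact: le_bigmax.
Qed.

(* The l^q norm as the library's L^q norm for the counting measure on nat. *)
Let ext x (k : nat) : R := if insub k is Some i then x 0 i else 0.

Let Lnorm_ext (r : R) x : 0 < r ->
  Lnorm counting r%:E (EFin \o ext x) =
  ((\sum_i `|x 0 i| `^ r) `^ r^-1)%:E.
Proof.
move=> r0; rewrite Lnorm_counting//.
rewrite (nneseries_split 0 n); last by move=> k; rewrite lee_fin powR_ge0.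
rewrite ereal_series_cond eseries0 ?adde0; last first.
  move=> k _; rewrite add0n andbT => nk.
  by rewrite /ext/= insubF ?normr0 ?powR0 ?gt_eqF// ltnNge nk.
rewrite add0n big_mkord -poweR_EFin -sumEFin; congr poweR.
by apply: eq_bigr => i _; rewrite /= /ext valK.
Qed.

Lemma lq_dist_triangle q y x z : (1 <= q)%E ->
  lq_dist q x z <= lq_dist q x y + lq_dist q y z.
Proof.
case: q => [r||] //= => [|_].
  rewrite lee_fin => r1; have r0 : 0 < r by rewrite (lt_le_trans _ r1).
  have mf v : measurable_fun setT (ext v) by [].
  have := minkowski_EFin counting (mf (x - y)) (mf (y - z)) r1.
  have -> : ext (x - y) \+ ext (y - z) = ext (x - z).
    apply/funext => k; rewrite /ext/=; case: insubP => [i _ _|_]; last first.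
      by rewrite addr0.
    by rewrite !mxE addrA subrK.
  rewrite !(Lnorm_ext _ r0) -EFinD lee_fin.
  have E (v w : 'rV[R]_n) :
      \sum_i `|(v - w) 0 i| `^ r = \sum_i `|v 0 i - w 0 i| `^ r.
    by apply: eq_bigr => i _; rewrite !mxE.
  by rewrite !E.
apply/bigmax_leP; split=> [|i _].
  by rewrite addr_ge0//; exact: bigmax_ge_id.
rewrite (le_trans (ler_distD (y 0 i) _ _))// lerD//.
  exact: (le_bigmax _ (fun i => `|x 0 i - y 0 i|)).
exact: (le_bigmax _ (fun i => `|y 0 i - z 0 i|)).
Qed.

End lq_metric.

(* The metric space (B_{l^p}(R^n), d_{l^q}); the proof of 1 <= q is what makes
   d_{l^q} a metric. *)
Definition lp_ball (R : realType) (n : nat) (p : R) (q : \bar R)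
    (q1 : (1 <= q)%E) : Type :=
  {x : 'rV[R]_n | \sum_i `|x 0 i| `^ p <= 1}.

Section lp_ball_metric.
Context {R : realType} {n : nat} {p : R} {q : \bar R} {q1 : (1 <= q)%E}.
Local Notation B := (lp_ball n p q1).

HB.instance Definition _ := Choice.on B.

Let dist (x y : B) : R := lq_dist q (sval x) (sval y).

Let distxx (x : B) : dist x x = 0.
Proof. exact: lq_distxx. Qed.

Let dist_eq0 (x y : B) : dist x y = 0 -> x = y.
Proof. by move=> xy; apply/val_inj; exact: lq_dist_eq0 xy. Qed.

Let dist_sym (x y : B) : dist x y = dist y x.
Proof. exact: lq_dist_sym. Qed.

Let dist_triangle (y x z : B) : dist x z <= dist x y + dist y z.
Proof. exact: lq_dist_triangle. Qed.

HB.instance Definition _ :=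
  isMetric.Build R B distxx dist_eq0 dist_sym dist_triangle.

Lemma lp_ball_mdistE (x y : B) : mdist x y = lq_dist q (sval x) (sval y).
Proof. by []. Qed.

End lp_ball_metric.

Lemma exponent_ge1 (R : realType) (p : R) (q : \bar R) :
  1 <= p -> (p%:E < q)%E -> (1 <= q)%E.
Proof. by move=> p1 /ltW; apply: le_trans; rewrite lee_fin. Qed.

(* Main.v *)
(** Let [t] be the [(k+1)]-st largest of the numbers [|x_i|].  Soft-thresholding
    [x] at level [t] moves every coordinate towards [0] by [min(|x_i|, t)]; it is
    continuous in [x], and the result has at most [k] nonzero coordinates, so it
    ranges over the cone on the [(k-1)]-skeleton of a cross-polytope, which is a
    subcomplex of the [k]-skeleton of the simplex with the same [2n+1] vertices.
    On the unit ball of [l^p] one has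
    [(k+1) t^p <= 1], whence
    [sum_i min(|x_i|, t)^q <= t^(q-p) sum_i |x_i|^p <= (k+1)^(-(q-p)/p)]:
    the map moves points by at most [(k+1)^(-1/r)], and its fibres have diameter
    at most twice that.  For [k = n] the threshold is [0] and the map is
    injective.  Eventual constancy follows because the width is bounded, and
    nondecreasing in [n] by the isometric inclusions of the balls. *)

Require Import Defs.
From HB Require Import structures.
From mathcomp Require Import all_boot all_order all_algebra finmap.
From mathcomp Require Import all_classical all_reals all_analysis.
From mathcomp Require Import zify lra ring.

Set Implicit Arguments.
Unset Strict Implicit.
Unset Printing Implicit Defensive.

Import Order.TTheory GRing.Theory Num.Theory.
Import numFieldNormedType.Exports.

Local Open Scope ring_scope.

(** * Polyhedra on finitely many vertices: continuity and skeleta *)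

Lemma continuous_polyhedron (R : realType) (X : topologicalType) (V : finType)
    (K : simplicial_complex V) (f : X -> polyhedron R K) :
  (forall v, continuous (fun x => f x v : R)) -> continuous f.
Proof.
move=> cf; apply/continuousP => U oU; rewrite openE => x Ufx.
(* There are only finitely many simplices, so a neighbourhood may be found for each one separately
   and the results intersected. *)
have near_bary (s : {fset V}) : \forall z \near x, simplex K s ->
    barycentric s (f z) -> U (f z).
  have [Ks|nKs] := pselect (simplex K s); last by apply: nearW => z /nKs.
  have [sfx|nsfx] := pselect (barycentric s (f x)).
    have [e e0 eU] := oU s Ks (f x) Ufx sfx.
    have : \forall z \near x, forall v, `|f x v - f z v| < e.
      apply: filter_forall => v.
      by have /cvgrPdist_lt /(_ e e0) := cf v x.
    by apply: filterS => z fz _ sfz; exact: eU sfz fz.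
  (* When [f x] lies off the closed simplex, some coordinate outside [s] is positive at [f x]; it
     stays positive nearby, so nearby values avoid the simplex too. *)
  have [v vs fv0] : exists2 v, v \notin s & 0 < f x v.
    apply: contrapT => nv; apply: nsfx.
    have [t _ [f0 ft f1]] := baryP (f x).
    have fs v : v \notin s -> f x v = 0.
      move=> vs; apply/eqP; rewrite eq_le f0 andbT leNgt; apply/negP => fv.
      by apply: nv; exists v.
    split=> //; rewrite -f1 !big_uniq ?fset_uniq//=.
    rewrite big_mkcond [RHS]big_mkcond/=.
    apply: eq_bigr => v _; case: ifPn => vs; case: ifPn => vt //.
      exact: ft.
    by rewrite fs.
  have /cvgrPdist_lt /(_ _ fv0) := cf v x.
  apply: filterS => z + _ [_ sz _].
  by rewrite (sz v vs) subr0 gtr0_norm// ltxx.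
have : \forall z \near x, forall s : {fset V}, simplex K s ->
  barycentric s (f z) -> U (f z) by exact: filter_forall.
by apply: filterS => z fz; have [s Ks sfz] := baryP (f z); exact: fz sfz.
Qed.

Section skeleton.
Context (V : finType) (k : nat).

Let skel (s : {fset V}) : Prop := s != fset0 /\ (#|` s| <= k.+1)%N.

Let skel_neq0 s : skel s -> s != fset0. Proof. by case. Qed.

Let skel_sub s t : skel s -> fsubset t s -> t != fset0 -> skel t.
Proof.
move=> [_ sk] ts t0; split=> //.
by apply: leq_trans sk; exact: fsubset_leq_card.
Qed.

Definition simplex_skeleton := SimplicialComplex skel_neq0 skel_sub.

Lemma cardfs_in (A : {set V}) : #|` [fset v in A]%fset| = #|A|.
Proof.
by rewrite -(card_uniqP (fset_uniq _)); apply: eq_card => v; rewrite !inE.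
Qed.

Lemma has_dim_skeleton : (k < #|V|)%N -> has_dim simplex_skeleton k.
Proof.
move=> kV; split=> [|s []//].
have [A kA] : exists A : {set V}, #|A| = k.+1.
  have /card_gt0P[A] : (0 < #|[set A : {set V} | #|A| == k.+1]|)%N.
    by rewrite card_draws bin_gt0.
  by rewrite inE => /eqP; exists A.
by exists [fset v in A]%fset; [split|]; rewrite -?cardfs_gt0 cardfs_in kA.
Qed.

Lemma bary_skeleton (R : realType) (w : V -> R) : (forall v, 0 <= w v) ->
  \sum_v w v = 1 -> (#|[set v | w v != 0%R]| <= k.+1)%N ->
  exists2 s, simplex simplex_skeleton s & barycentric s w.
Proof.
move=> w0 w1 wk; exists [fset v in [set v | w v != 0%R]]%fset.
  split; rewrite ?cardfs_in// -cardfs_gt0 cardfs_in lt0n cards_eq0.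
  apply/eqP => /setP ws; have /eqP := w1; rewrite big1 ?(eq_sym 0) ?oner_eq0//.
  by move=> v _; apply/eqP; have := ws v; rewrite !inE => /negbFE.
split=> [//|v|]; first by rewrite !inE negbK => /eqP.
rewrite big_uniq ?fset_uniq//= -w1 [RHS](bigID (fun v => w v != 0))/=.
rewrite [X in _ = _ + X]big1 ?addr0 => [|v]; last by rewrite negbK => /eqP.
by apply: eq_bigl => v; rewrite !inE.
Qed.

End skeleton.

(** * Order statistics of the absolute coordinates *)

(* The [k.+1]-st largest of the numbers [`|x 0 i|], or [0] if [n <= k], as a
   min-max over the sets of at most [k] discarded coordinates. *)
Section threshold.
Context (R : realType) (n : nat).
Implicit Types (x y : 'rV[R]_n) (S : {set 'I_n}).

Definition tail_max x S : R := \big[Num.max/0]_(i in ~: S) `|x 0 i|.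

Definition threshold k x :=
  tail_max x [arg min_(S < finset.set0 | (#|S| <= k)%N) tail_max x S]%O.

Lemma threshold_min k x : exists S, [/\ (#|S| <= k)%N,
  threshold k x = tail_max x S &
  forall T : {set 'I_n}, (#|T| <= k)%N -> threshold k x <= tail_max x T].
Proof.
rewrite /threshold; case: arg_minP; first by rewrite cards0.
by move=> S Sk Smin; exists S.
Qed.

Lemma threshold_ge0 k x : 0 <= threshold k x.
Proof. exact: bigmax_ge_id. Qed.

Lemma threshold_full x : threshold n x = 0.
Proof.
apply/eqP; rewrite eq_le threshold_ge0 andbT.
have [S [_ _ tmin]] := threshold_min n x.
have := tmin [set: 'I_n]; rewrite cardsT card_ord leqnn => /(_ isT).
by rewrite /tail_max big_pred0// => i; rewrite !inE.
Qed.

(** A coordinate strictly above the threshold must belong to the minimising discarded set. *)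
Lemma card_gt_threshold k x :
  (#|[set i | (threshold k x < `|x 0%R i|)%R]| <= k)%N.
Proof.
have [S [Sk -> _]] := threshold_min k x; apply: leq_trans Sk.
apply/subset_leq_card/fintype.subsetP => i; rewrite inE; apply: contraTT => iS.
by rewrite -leNgt; apply: (le_bigmax_cond 0 (fun i => `|x 0 i|)); rewrite inE.
Qed.

(** Otherwise these coordinates could all be discarded, leaving a strictly smaller tail. Positivity
    is what makes it strict, since an empty maximum is [0]. *)
Lemma card_ge_threshold k x : 0 < threshold k x ->
  (k < #|[set i | (threshold k x <= `|x 0%R i|)%R]|)%N.
Proof.
have [S [_ _ tmin]] := threshold_min k x => t0.
rewrite ltnNge; apply/negP => /tmin; rewrite leNgt => /negP; apply.
by apply: bigmax_lt => // i; rewrite !inE -ltNge.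
Qed.

(** Each [tail_max] is 1-Lipschitz in the sup norm, hence so is their minimum: evaluate at one point
    the minimiser of the other. *)
Lemma threshold_lipschitz k x y d : 0 <= d ->
  (forall i, `|x 0 i - y 0 i| <= d) -> `|threshold k x - threshold k y| <= d.
Proof.
move=> d0 xy; have tail (u v : 'rV[R]_n) S :
    (forall i, `|u 0 i - v 0 i| <= d) -> tail_max u S <= tail_max v S + d.
  move=> uv; apply: bigmax_le => [|i iS].
    by rewrite addr_ge0//; exact: bigmax_ge_id.
  rewrite -[u 0 i](subrK (v 0 i)) addrC (le_trans (ler_normD _ _))// lerD//.
  exact: (le_bigmax_cond 0 (fun i => `|v 0 i|)).
rewrite ler_norml lerBDl lerBlDr.
have [S [Sk Sx xmin]] := threshold_min k x.
have [T [Tk Ty ymin]] := threshold_min k y.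
rewrite lerBlDr (le_trans (ymin S Sk)) ?Sx ?tail//=; last first.
  by move=> i; rewrite distrC.
by rewrite addrC -Sx Ty (le_trans (xmin T Tk))// tail.
Qed.

(** Chebyshev's inequality: at least [k.+1] terms of the sum are no smaller than the [p]-th power of
    the threshold. *)
Lemma threshold_lp_ball k (p : R) x : 0 < p -> \sum_i `|x 0 i| `^ p <= 1 ->
  threshold k x `^ p <= k.+1%:R^-1.
Proof.
move=> p0 x1; have := threshold_ge0 k x; rewrite le_eqVlt => /predU1P[<-|t0].
  by rewrite powR0 ?gt_eqF// invr_ge0.
rewrite -[X in _ <= X]mul1r ler_pdivlMr// mulr_natr; apply: le_trans x1.
have kA := card_ge_threshold t0.
apply: (@le_trans _ _ (threshold k x `^ p *+
    #|[set i | (threshold k x <= `|x 0%R i|)%R]|)).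
  by rewrite ler_wpMn2l// powR_ge0.
rewrite -sumr_const big_mkcond/=; apply: ler_sum => i _.
case: ifPn => [|_]; last exact: powR_ge0.
by rewrite inE; apply: ge0_ler_powR; rewrite ?nnegrE// ltW.
Qed.

End threshold.

(** * Soft-thresholding and its displacement in the [q]-metric *)

(** For [t >= 0] this is [sign(a) * max(|a| - t, 0)], split into positive and negative parts because
    these become the weights of two opposite vertices. *)
Definition soft (R : realDomainType) (t a : R) : R :=
  Num.max (a - t) 0 - Num.max (- a - t) 0.

Lemma soft0 (R : realDomainType) (a : R) : soft 0 a = a.
Proof. by rewrite /soft !subr0; case: (leP a 0); case: (leP (- a) 0); lra. Qed.

Lemma soft_dist (R : realFieldType) (t a : R) : 0 <= t ->
  `|a - soft t a| <= Num.min t `|a|.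
Proof.
move=> t0; rewrite /soft le_min.
case: (leP (a - t) 0) => h1; case: (leP (- a - t) 0) => h2;
  case: (leP 0 a) => a0; rewrite ?(ger0_norm a0) ?(ltr0_norm a0) !ler_norml;
  lra.
Qed.

(** Makes coordinates, and through [threshold_lipschitz] the threshold, 1-Lipschitz on the ball. *)
Lemma lq_dist_coord (R : realType) (n : nat) (q : \bar R) (x y : 'rV[R]_n) i :
  (1 <= q)%E -> `|x 0 i - y 0 i| <= lq_dist q x y.
Proof.
case: q => [s||] //= => [|_]; last first.
  exact: (le_bigmax _ (fun i => `|x 0 i - y 0 i|)).
rewrite lee_fin => s1; have s0 : 0 < s by rewrite (lt_le_trans _ s1).
rewrite -[leLHS]powRr1// -(mulfV (lt0r_neq0 s0)) powRrM.
apply: ge0_ler_powR; rewrite ?nnegrE ?invr_ge0 ?powR_ge0 ?(ltW s0)//.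
  by apply: sumr_ge0 => j _; exact: powR_ge0.
by rewrite (bigD1 i)//= lerDl sumr_ge0// => j _; exact: powR_ge0.
Qed.

Section soft_threshold.
Context (R : realType) (p : R) (q : \bar R) (r : R).
Hypotheses (p1 : 1 <= p) (pq : (p%:E < q)%E).
Hypothesis pqr : (p%:E^-1 - q^-1 = r%:E^-1)%E.

Let p0 : 0 < p. Proof. exact: lt_le_trans p1. Qed.

Lemma inv_exponent_gap :
  match q with s%:E => p^-1 - s^-1 = r^-1 /\ p < s | +oo%E => p^-1 = r^-1
  | -oo%E => False end.
Proof.
case: q pq pqr => [s||]//; rewrite !inver ?(gt_eqF p0).
  rewrite lte_fin => ps; rewrite (gt_eqF (lt_trans p0 ps)).
  (* If [r = 0], its extended inverse is [+oo], which cannot equal the finite left-hand side. *)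
  by case: eqP => // _ [].
by move=> _; rewrite /= sube0; case: eqP => // _ [].
Qed.

Lemma exponent_gap_gt0 : 0 < r.
Proof.
rewrite -invr_gt0; have := inv_exponent_gap.
case: q => [s [<- ps]|<-|]//; last by rewrite invr_gt0.
by rewrite subr_gt0 ltf_pV2// posrE// (lt_trans p0).
Qed.

Definition soft_threshold n k (x : 'rV[R]_n) : 'rV[R]_n :=
  \row_i soft (threshold k x) (x 0 i).

Lemma lq_dist_soft_threshold n k (x : 'rV[R]_n) :
  \sum_i `|x 0 i| `^ p <= 1 ->
  lq_dist q x (soft_threshold k x) <= k.+1%:R `^ (- r^-1).
Proof.
move=> x1; set t := threshold k x; have t0 : 0 <= t := threshold_ge0 k x.
have xt i : `|x 0 i - soft_threshold k x 0 i| <= Num.min t `|x 0 i|.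
  by rewrite mxE soft_dist.
have tK : t <= k.+1%:R `^ (- p^-1).
  rewrite -[leLHS]powRr1// -[X in t `^ X](mulfV (lt0r_neq0 p0)) powRrM.
  rewrite -mulN1r powRrM powR_inv1//; apply: ge0_ler_powR.
  - by rewrite invr_ge0 ltW.
  - by rewrite nnegrE powR_ge0.
  - by rewrite nnegrE invr_ge0.
  - exact: threshold_lp_ball.
have := inv_exponent_gap; case: q => [s [<- ps]|<-|//]; last first.
  apply: bigmax_le => [|i _]; first exact: powR_ge0.
  by apply: le_trans tK; have := xt i; rewrite le_min => /andP[].
have s0 : 0 < s by apply: lt_trans ps.
(* This factorisation of the exponent lets the outer root [s^-1] be stripped and [tK] be raised to
   the power [s - p]. *)
have -> : - (p^-1 - s^-1) = - p^-1 * (s - p) * s^-1.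
  by field; rewrite !gt_eqF.
rewrite powRrM; apply: ge0_ler_powR.
- by rewrite invr_ge0 ltW.
- by rewrite nnegrE sumr_ge0// => i _; exact: powR_ge0.
- by rewrite nnegrE powR_ge0.
apply: (@le_trans _ _ (t `^ (s - p))); last first.
  rewrite powRrM; apply: ge0_ler_powR; rewrite ?nnegrE ?powR_ge0//.
  by rewrite subr_ge0 ltW.
rewrite -[leRHS]mulr1; apply: le_trans (ler_wpM2l (powR_ge0 _ _) x1).
rewrite mulr_sumr; apply: ler_sum => i _.
have := xt i; rewrite le_min => /andP[bt bx].
(* Of the displacement to the power [s], the factor of exponent [s - p] is bounded through [t], the
   factor of exponent [p] through the coordinate itself. *)
have -> : s = (s - p) + p by rewrite subrK.
rewrite powRD ?subrK ?(gt_eqF s0)//; apply: ler_pM; rewrite ?powR_ge0 ?addrK//.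
  by apply: ge0_ler_powR; rewrite ?nnegrE// subr_ge0 ltW.
by apply: ge0_ler_powR; rewrite ?nnegrE// ltW.
Qed.

End soft_threshold.

(** * Barycentric coordinates on the cone over the cross-polytope *)

Lemma big_option (T : Type) (idx : T) (op : Monoid.com_law idx) (I : finType)
    (F : option I -> T) :
  \big[op/idx]_v F v = op (F None) (\big[op/idx]_i F (Some i)).
Proof.
rewrite (bigD1 None)//=; congr (op _ _).
rewrite (reindex_omap Some id)/=; last by case.
by apply: eq_bigl => i; rewrite eqxx.
Qed.

(* Barycentric coordinates of [soft_threshold k x / n] in the cone, with apex
   [None] at the origin, over the cross-polytope whose vertices
   [Some (i, false)] and [Some (i, true)] are [e_i] and [- e_i]. *)
Section cone_weight.
Context (R : realType) (n k : nat).
Hypothesis n0 : (0 < n)%N.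
Implicit Types (x : 'rV[R]_n).

Definition vertex_weight x (j : 'I_n * bool) : R :=
  Num.max ((-1) ^+ j.2 * x 0 j.1 - threshold k x) 0 / n%:R.

Definition cone_weight x (v : option ('I_n * bool)) : R :=
  if v is Some j then vertex_weight x j else 1 - \sum_j vertex_weight x j.

Let nR : 0 < n%:R :> R. Proof. by rewrite ltr0n. Qed.

Lemma vertex_weight_soft x i :
  vertex_weight x (i, false) - vertex_weight x (i, true) =
  soft_threshold k x 0 i / n%:R.
Proof.
by rewrite /vertex_weight mxE /soft mulrBl/= expr0 expr1 mul1r mulN1r.
Qed.

Lemma vertex_weight_ge0 x j : 0 <= vertex_weight x j.
Proof. by rewrite divr_ge0 ?(ltW nR)// le_max lexx orbT. Qed.

(** Two opposite vertices together weigh [max(|x_i| - t, 0) / n <= 1 / n], with [t] the threshold;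
    the division by [n] serves to leave a nonnegative weight for the apex. *)
Lemma sum_vertex_weight_le1 x : (forall i, `|x 0 i| <= 1) ->
  \sum_j vertex_weight x j <= 1.
Proof.
move=> x1; rewrite -(pair_bigA _ (fun i b => vertex_weight x (i, b)))/=.
apply: (@le_trans _ _ (\sum_(i < n) n%:R^-1)); last first.
  by rewrite sumr_const card_ord -[leLHS]mulr_natr mulVf ?gt_eqF.
apply: ler_sum => i _; rewrite big_bool/= -mulrDl -[leRHS]mul1r.
rewrite ler_wpM2r ?invr_ge0 ?(ltW nR)//= expr0 expr1 mul1r mulN1r.
have := x1 i; rewrite ler_norml => /andP[xi1 xi2]; have := threshold_ge0 k x.
case: (leP (x 0 i - threshold k x)); case: (leP (- x 0 i - threshold k x)); lra.
Qed.

Lemma cone_weight_ge0 x v : (forall i, `|x 0 i| <= 1) -> 0 <= cone_weight x v.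
Proof.
move=> x1; case: v => [j|]; first exact: vertex_weight_ge0.
by rewrite subr_ge0 sum_vertex_weight_le1.
Qed.

Lemma sum_cone_weight x : \sum_v cone_weight x v = 1.
Proof. by rewrite big_option/= subrK. Qed.

(** The support consists of at most the apex and, for each coordinate exceeding the threshold, the
    one vertex selected by its sign. *)
Lemma card_supp_cone_weight x :
  (#|[set v | cone_weight x v != 0%R]| <= k.+1)%N.
Proof.
pose A := [set i | (threshold k x < `|x 0%R i|)%R].
pose B := [set Some (i, (x 0%R i < 0)%R) | i in A].
apply: (@leq_trans #|None |: B|); last first.
  rewrite cardsU1 -add1n leq_add//; first by case: (_ \notin _).
  by rewrite (leq_trans (leq_imset_card _ _))// card_gt_threshold.
apply/subset_leq_card/fintype.subsetP => -[[i b]|]; rewrite !inE//=.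
rewrite mulf_eq0 invr_eq0 (gt_eqF nR) orbF => wi.
have {wi} : 0 < (-1) ^+ b * x 0 i - threshold k x.
  rewrite ltNge; apply: contraNN wi => wi.
  by apply/eqP; apply/max_idPr.
have := threshold_ge0 k x; case: b => /= t0; rewrite ?expr1 ?expr0 => xt.
  have xi : x 0 i < 0 by lra.
  apply/imsetP; exists i; last by rewrite xi.
  by rewrite inE ltr0_norm//; lra.
have xi : 0 < x 0 i by lra.
apply/imsetP; exists i; last by rewrite ltNge ltW.
by rewrite inE gtr0_norm//; lra.
Qed.

(** The difference of the weights at opposite vertices recovers a coordinate of [soft_threshold], up
    to the factor [n]. *)
Lemma cone_weight_inj x y : cone_weight x =1 cone_weight y ->
  soft_threshold k x = soft_threshold k y.
Proof.
move=> xy; apply/rowP => i; apply: (mulIf (invr_neq0 (lt0r_neq0 nR))).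
rewrite -!vertex_weight_soft.
by have /= -> := xy (Some (i, false)); have /= -> := xy (Some (i, true)).
Qed.

Lemma cone_weight_continuous (X : topologicalType) (g : X -> 'rV[R]_n) :
  (forall i, continuous (fun z => g z 0 i : R)) ->
  continuous (fun z => threshold k (g z) : R) ->
  forall v, continuous (fun z => cone_weight (g z) v : R).
Proof.
move=> cg ct; have cw j : continuous (fun z => vertex_weight (g z) j : R).
  move=> z; apply: (@cvgMr_tmp _ _ _ _ (fun z => Num.max _ _)).
  apply: (@continuous_max _ _ (fun z => _ - _) (fun=> 0)); last exact: cvg_cst.
  by apply: cvgB (ct z); apply: cvgMl_tmp; exact: cg.
case=> [j|]; first exact: cw.
move=> z; apply: cvgB; first exact: cvg_cst.
apply: (@continuous_big R^o _ +%R 0 xpredT _ X _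
  (fun j z => vertex_weight (g z) j)) => [|j _]; last exact: cw.
exact: add_continuous.
Qed.

End cone_weight.

(** * Widths, isometries and inclusions of balls *)

Lemma mdist_lipschitz1_continuous (R : realType) (X : metricType R)
    (g : X -> R) :
  (forall x y, `|g x - g y| <= mdist x y) -> continuous g.
Proof.
move=> gl x; apply/cvgrPdist_lt => e e0; apply/nbhs_ballP; exists e => //.
by move=> y; rewrite ballEmdist/=; apply: le_lt_trans.
Qed.

Lemma eps_embeds_is_Widim (R : realType) (X : metricType R) (eps : R) m :
  eps_embeds_in_dim X eps m -> exists2 k, is_Widim X eps k & (k <= m)%N.
Proof.
move=> Xm; have ex : exists k, `[< eps_embeds_in_dim X eps k >].
  by exists m; apply/asboolP.
case: (ex_minnP ex) => k /asboolP Xk kmin.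
by exists k; [split=> // j Xj|]; apply: kmin; apply/asboolP.
Qed.

Lemma eps_embeds_isometry (R : realType) (X Y : metricType R) (g : X -> Y)
    (eps : R) k : (forall x y, mdist (g x) (g y) = mdist x y) ->
  eps_embeds_in_dim Y eps k -> eps_embeds_in_dim X eps k.
Proof.
move=> gd [V [K [f [dimK [cf fd]]]]].
exists V, K, (f \o g); split=> //; split=> [x|y].
  apply: continuous_comp; last exact: cf.
  move=> A /nbhs_ballP[e e0 eA]; apply/nbhs_ballP; exists e => // z.
  by rewrite ballEmdist/= -gd => xz; apply: eA; rewrite ballEmdist.
apply: le_trans (fd y); apply: ge_ereal_sup => _ [[u v] [/= fu fv] <-].
by apply: ereal_sup_ubound; exists (g u, g v); rewrite //= gd.
Qed.

Section lp_ball_embedding.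
Context (R : realType) (p : R) (q : \bar R) (q1 : (1 <= q)%E).

Lemma lp_ball_coord n (x : 'rV[R]_n) i : 1 <= p ->
  \sum_i `|x 0 i| `^ p <= 1 -> `|x 0 i| <= 1.
Proof.
move=> p1 x1; rewrite leNgt; apply/negP => xi.
have : 1 < `|x 0 i| `^ p.
  apply: (lt_le_trans xi); rewrite -[leLHS]powRr1//; apply: ler_powR => //.
  exact: ltW.
apply/negP; rewrite -leNgt; apply: le_trans x1.
by rewrite (bigD1 i)//= lerDl sumr_ge0// => j _; exact: powR_ge0.
Qed.

(** Padding by zeros is an isometry, so an embedding of the larger ball restricts to the smaller
    one. *)
Lemma lp_ball_widen (m n : nat) (eps : R) k : 0 < p ->
  eps_embeds_in_dim (lp_ball (m + n) p q1) eps k ->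
  eps_embeds_in_dim (lp_ball m p q1) eps k.
Proof.
move=> p0 H.
have g1 (x : lp_ball m p q1) :
    \sum_i `|row_mx (sval x) (0 : 'rV[R]_n) 0 i| `^ p <= 1.
  rewrite big_split_ord/= [X in _ + X]big1 => [|i _]; last first.
    by rewrite row_mxEr mxE normr0 powR0 ?gt_eqF.
  by rewrite addr0; under eq_bigr do rewrite row_mxEl; exact: (svalP x).
pose h (x : lp_ball m p q1) : lp_ball (m + n) p q1 := 
  exist (fun z : 'rV[R]_(m + n) => \sum_i `|z 0 i| `^ p <= 1) _ (g1 x).
apply: (eps_embeds_isometry (g := h)) H => x y; rewrite !lp_ball_mdistE/=.
case: q q1 => [s||]//= s1.
  have s0 : s != 0 by rewrite gt_eqF// (lt_le_trans ltr01)// -lee_fin.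
  congr (_ `^ _); rewrite big_split_ord/= [X in _ + X]big1 => [|i _].
    by rewrite addr0; under eq_bigr do rewrite !row_mxEl.
  by rewrite !row_mxEr subrr normr0 powR0.
apply/eqP; rewrite eq_le; apply/andP; split; apply: bigmax_le => [|i _].
- exact: bigmax_ge_id.
- case: (split_ordP i) => j ->; rewrite ?row_mxEl ?row_mxEr.
    exact: (le_bigmax _ (fun i => `|sval x 0 i - sval y 0 i|)).
  by rewrite subrr normr0; exact: bigmax_ge_id.
- exact: bigmax_ge_id.
- apply: le_trans (le_bigmax _ _ (lshift n i)).
  by rewrite !row_mxEl.
Qed.

End lp_ball_embedding.

(** * The embedding, the bound and eventual constancy *)

Lemma lp_ball_eps_embeds (R : realType) (p : R) (q : \bar R) (r : R)
    (p1 : 1 <= p) (pq : (p%:E < q)%E) (q1 : (1 <= q)%E) :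
  (p%:E^-1 - q^-1 = r%:E^-1)%E ->
  forall (eps : R) (n k : nat), 0 < eps -> (0 < n)%N -> (k <= n)%N ->
  2 * k.+1%:R `^ (- r^-1) <= eps \/ k = n ->
  eps_embeds_in_dim (lp_ball n p q1) eps k.
Proof.
move=> pqr eps n k eps0 n0 kn keps.
have x1 (x : lp_ball n p q1) i : `|sval x 0 i| <= 1.
  exact: (lp_ball_coord i p1 (svalP x)).
have wP x := bary_skeleton (fun v => cone_weight_ge0 k n0 v (x1 x))
  (sum_cone_weight k (sval x)) (card_supp_cone_weight k n0 (sval x)).
exists (option ('I_n * bool)), (simplex_skeleton _ k).
exists (fun x => Polyhedron (wP x)); split.
  apply: has_dim_skeleton; rewrite card_option card_prod card_ord card_bool.
  by rewrite ltnS (leq_trans kn)// leq_pmulr.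
split.
  apply: continuous_polyhedron => v /=.
  apply: (@cone_weight_continuous _ _ k _ (fun z : lp_ball n p q1 => sval z)).
    move=> i; apply: mdist_lipschitz1_continuous => x y.
    by rewrite lp_ball_mdistE lq_dist_coord.
  apply: mdist_lipschitz1_continuous => x y.
  apply: threshold_lipschitz; rewrite ?mdist_ge0// => i.
  by rewrite lp_ball_mdistE lq_dist_coord.
move=> y; apply: ge_ereal_sup => _ [[u v] [/= fu fv] <-].
rewrite lee_fin lp_ball_mdistE.
have uv : soft_threshold k (sval u) = soft_threshold k (sval v).
  apply: (cone_weight_inj n0) => z.
  by have := congr1 (fun P => bary P z) (etrans fu (esym fv)).
case: keps => [keps|kn']; last first.
  have st (x : 'rV[R]_n) : soft_threshold k x = x.
    by apply/rowP => i; rewrite mxE kn' threshold_full soft0.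
  by move: uv; rewrite !st => ->; rewrite lq_distxx// ltW.
(* Points of one fibre share their soft-thresholding, so the triangle inequality through it costs
   two displacements. *)
apply: le_trans keps; rewrite mulr_natl mulr2n.
apply: (le_trans (lq_dist_triangle (soft_threshold k (sval u)) _ _ q1)).
apply: lerD; first exact: (lq_dist_soft_threshold p1 pq pqr k (svalP u)).
rewrite uv lq_dist_sym.
exact: (lq_dist_soft_threshold p1 pq pqr k (svalP v)).
Qed.

Theorem theorem1p1 (R : realType) (p : R) (q : \bar R)
    (p1 : 1 <= p) (pq : (p%:E < q)%E)
    (r : R) (pqr : (p%:E^-1 - q^-1 = r%:E^-1)%E) :
  (forall (eps : R) (n : nat), 0 < eps -> (1 <= n)%N ->
    exists2 k : nat, is_Widim (lp_ball n p (exponent_ge1 p1 pq)) eps k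
      & k%:Z <= Num.min n%:Z (Num.ceil ((2 / eps) `^ r) - 1)) /\
  (forall eps : R, 0 < eps -> exists k N : nat, forall n : nat,
    (1 <= n)%N -> (N <= n)%N ->
    is_Widim (lp_ball n p (exponent_ge1 p1 pq)) eps k).
Proof.
have r0 := exponent_gap_gt0 p1 pq pqr.
have bound : forall (eps : R) (n : nat), 0 < eps -> (1 <= n)%N ->
    exists2 k : nat, is_Widim (lp_ball n p (exponent_ge1 p1 pq)) eps k
      & k%:Z <= Num.min n%:Z (Num.ceil ((2 / eps) `^ r) - 1).
  move=> eps n eps0 n0; set c := Num.ceil _.
  have c0 : 0 < c by rewrite ceil_gt0 powR_gt0// divr_gt0.
  (* Here [m] is the ceiling minus one, a natural number because the ceiling is positive. *)
  have [m cm] : exists m : nat, c = m.+1%:Z.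
    by case: c c0 => // -[|m]// _; exists m.
  (* Equivalent to [(2 / eps) ^ r <= m + 1], which holds by the choice of the ceiling. *)
  have mP : 2 * m.+1%:R `^ (- r^-1) <= eps.
    rewrite powRN ler_pdivrMr ?powR_gt0// mulrC -ler_pdivrMr//.
    rewrite -[leLHS]powRr1 ?divr_ge0 ?(ltW eps0)//.
    rewrite -[X in _ `^ X](mulfV (lt0r_neq0 r0)) powRrM.
    apply: ge0_ler_powR; rewrite ?nnegrE ?powR_ge0 ?invr_ge0 ?(ltW r0)//.
    by have := ceil_ge ((2 / eps) `^ r); rewrite -/c cm.
  have [k Wk kmn] : exists2 k : nat,
      is_Widim (lp_ball n p (exponent_ge1 p1 pq)) eps k & (k <= minn n m)%N.
    apply/eps_embeds_is_Widim/(lp_ball_eps_embeds p1 pq _ pqr) => //.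
      exact: geq_minl.
    (* If [n <= m] the dimension is [n] and the injective case applies; otherwise it is [m] and [mP]
       applies. *)
    by case: (leqP n m) => nm; [right|left].
  exists k => //; rewrite cm -[m.+1]addn1 PoszD addrK le_min !lez_nat.
  by rewrite -leq_min.
split=> // eps eps0.
pose P k := `[< exists2 n, (0 < n)%N &
  is_Widim (lp_ball n p (exponent_ge1 p1 pq)) eps k >].
have exP : exists k, P k.
  have [k Wk _] := bound eps 1%N eps0 isT.
  by exists k; apply/asboolP; exists 1%N.
have Wuniq n i j : is_Widim (lp_ball n p (exponent_ge1 p1 pq)) eps i ->
    is_Widim (lp_ball n p (exponent_ge1 p1 pq)) eps j -> i = j.
  by move=> [Wi mini] [Wj minj]; apply/eqP; rewrite eqn_leq mini ?minj.
have ubP k : P k -> (k <= `|Num.ceil ((2 / eps) `^ r) - 1|)%N.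
  move=> /asboolP[n n0 Wk]; have [j /Wuniq /(_ Wk) ->] := bound eps n eps0 n0.
  by rewrite le_min => /andP[_]; lia.
(* Take the largest width [k] over all dimensions, attained at [N]. For [n >= N] the width is at
   most [k] by maximality, and at least [k] because an embedding of the [n]-ball restricts to the
   [N]-ball. *)
case: (ex_maxnP exP ubP) => k /asboolP[N N0 WN] kmax; exists k, N => n n0 Nn.
have [j Wj _] := bound eps n eps0 n0.
suff -> : k = j by [].
apply/eqP; rewrite eqn_leq kmax; last by apply/asboolP; exists n.
rewrite andbT; have [_ minN] := WN; apply: minN.
have [emb _] := Wj; move: emb; rewrite -(subnKC Nn).
by apply: lp_ball_widen; exact: lt_le_trans ltr01 p1.
Qed.
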